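(* Let $\mathcal{G}$ be the planar Galilean conformal algebra over $\mathbb{C}$. Every 2-local derivation $\Delta:\mathcal{G}\to\mathcal{G}$ is a derivation of $\mathcal{G}$.
   Context: All vector spaces and algebras are over $\mathbb{C}$. The planar Galilean conformal algebra $\mathcal{G}$ is the complex Lie algebra with basis $\{L_m,H_m,I_m,J_m\mid m\in\mathbb{Z}\}$ and Lie brackets, for all $m,n\in\mathbb{Z}$, $$[L_n,L_m]=(m-n)L_{m+n},\quad [L_n,H_m]=mH_{m+n},\quad [L_n,I_m]=(m-n)I_{m+n},$$ $$[L_n,J_m]=(m-n)J_{m+n},\quad [H_n,I_m]=I_{m+n},\quad [H_n,J_m]=-J_{m+n},$$ all other brackets of basis elements (not determined by antisymmetry) being zero. A derivation of a Lie algebra $\mathcal{L}$ is a linear map $D:\mathcal{L}\to\mathcal{L}$ with $D([x,y])=[D(x),y]+[x,D(y)]$ for all $x,y\in\mathcal{L}$; $\mathrm{Der}(\mathcal{L})$ denotes the set of derivations. A 2-local derivation on $\mathcal{L}$ is a map $\Delta:\mathcal{L}\to\mathcal{L}$ (not assumed linear) such that for any $x,y\in\mathcal{L}$ there exists $\Delta_{x,y}\in\mathrm{Der}(\mathcal{L})$ (depending on $x,y$) with $\Delta(x)=\Delta_{x,y}(x)$ and $\Delta(y)=\Delta_{x,y}(y)$. *)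

(* Defs.v *)
From HB Require Import structures.
From mathcomp Require Import all_boot all_order all_algebra.
From mathcomp Require Import finmap monalg.
From mathcomp Require Import reals complex.
From mathcomp Require Import ring.

Set Implicit Arguments.
Unset Strict Implicit.
Unset Printing Implicit Defensive.

Import GRing.Theory Num.Theory.
Local Open Scope ring_scope.

Section LieAlgebra.
Variables (F : fieldType) (V : lmodType F) (br : V -> V -> V).

Definition is_lie_bracket : Prop :=
  [/\ forall y, linear (br^~ y),
      forall x, linear (br x),
      forall x, br x x = 0
    & forall x y z, br x (br y z) + br y (br z x) + br z (br x y) = 0].

Definition is_derivation (D : V -> V) : Prop :=
  linear D /\ forall x y, D (br x y) = br (D x) y + br x (D y).

(* [Delta] is an arbitrary map: no linearity is assumed. *)
Definition is_2local_derivation (Delta : V -> V) : Prop :=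
  forall x y, exists D, [/\ is_derivation D, Delta x = D x & Delta y = D y].

End LieAlgebra.

Variant gca_basis : Type :=
  | gL of int | gH of int | gI of int | gJ of int.

Definition gca_basis_encode (b : gca_basis) : (int + int) + (int + int) :=
  match b with
  | gL m => inl (inl m) | gH m => inl (inr m)
  | gI m => inr (inl m) | gJ m => inr (inr m)
  end.

Definition gca_basis_decode (s : (int + int) + (int + int)) : gca_basis :=
  match s with
  | inl (inl m) => gL m | inl (inr m) => gH m
  | inr (inl m) => gI m | inr (inr m) => gJ m
  end.

Lemma gca_basis_encodeK : cancel gca_basis_encode gca_basis_decode.
Proof. by case. Qed.

HB.instance Definition _ := Choice.copy gca_basis (can_type gca_basis_encodeK).

(* The free vector space on the basis: finitely supported functions from
   [gca_basis] to [F]. The basis vector of index [b] is [<< b >>]. *)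
Notation gca F := {malg F[gca_basis]}.

Section PlanarGalilean.
Variable F : fieldType.

Definition gca_basis_bracket (a b : gca_basis) : gca F :=
  match a, b with
  | gL n, gL m => (m - n)%:~R *: << gL (m + n) >>
  | gL n, gH m => m%:~R *: << gH (m + n) >>
  | gL n, gI m => (m - n)%:~R *: << gI (m + n) >>
  | gL n, gJ m => (m - n)%:~R *: << gJ (m + n) >>
  | gH n, gI m => << gI (m + n) >>
  | gH n, gJ m => - << gJ (m + n) >>
  (* the brackets forced by antisymmetry *)
  | gH n, gL m => - (n%:~R *: << gH (m + n) >>)
  | gI n, gL m => - ((n - m)%:~R *: << gI (m + n) >>)
  | gJ n, gL m => - ((n - m)%:~R *: << gJ (m + n) >>)
  | gI n, gH m => - << gI (m + n) >>
  | gJ n, gH m => << gJ (m + n) >>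
  | _, _ => 0
  end.

Definition gca_bracket (x y : gca F) : gca F :=
  \sum_(a <- msupp x) \sum_(b <- msupp y)
    (x@_a * y@_b) *: gca_basis_bracket a b.

(* Bookkeeping for the Jacobi identity: [x] is [c] times [v]. *)
Section Coordinate.
Variable V : lmodType F.
Implicit Types (v x y : V) (c d : F).

Definition is_coord v x c := x = c *: v.

Lemma is_coord0 v : is_coord v 0 0.
Proof. by rewrite /is_coord scale0r. Qed.

Lemma is_coord1 v : is_coord v v 1.
Proof. by rewrite /is_coord scale1r. Qed.

Lemma is_coordD v x y c d :
  is_coord v x c -> is_coord v y d -> is_coord v (x + y) (c + d).
Proof. by rewrite /is_coord scalerDl => -> ->. Qed.

Lemma is_coordN v x c :
  is_coord v x c -> is_coord v (- x) (- c).
Proof. by rewrite /is_coord scaleNr => ->. Qed.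

Lemma is_coordZ v x a c :
  is_coord v x c -> is_coord v (a *: x) (a * c).
Proof. by rewrite /is_coord -scalerA => ->. Qed.

Lemma is_coordP v x c :
  is_coord v x c -> c = 0 -> x = 0.
Proof. by move=> -> ->; rewrite scale0r. Qed.

End Coordinate.

Lemma gca_bracketEw (d1 d2 : {fset gca_basis}) (x y : gca F) :
  (msupp x `<=` d1)%fset -> (msupp y `<=` d2)%fset ->
  gca_bracket x y =
  \sum_(a <- d1) \sum_(b <- d2) (x@_a * y@_b) *: gca_basis_bracket a b.
Proof.
move=> sx sy; rewrite /gca_bracket (big_fset_incl _ sx) /=; last first.
  move=> a _ /mcoeff_outdom xa0; rewrite big1 // => b _.
  by rewrite xa0 mul0r scale0r.
apply: eq_bigr => a _; rewrite (big_fset_incl _ sy) //= => b _.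
by move=> /mcoeff_outdom ->; rewrite mulr0 scale0r.
Qed.

Lemma gca_bracket_linearl (y : gca F) : linear (gca_bracket^~ y).
Proof.
move=> c x1 x2 /=.
pose d := (msupp (c *: x1 + x2) `|` (msupp x1 `|` msupp x2))%fset.
have s0 : (msupp (c *: x1 + x2) `<=` d)%fset by rewrite fsubsetUl.
have s1 : (msupp x1 `<=` d)%fset.
  by rewrite fsubsetU // fsubsetUl orbT.
have s2 : (msupp x2 `<=` d)%fset.
  by rewrite fsubsetU // fsubsetUr orbT.
have sy := fsubset_refl (msupp y).
rewrite (gca_bracketEw s0 sy) (gca_bracketEw s1 sy) (gca_bracketEw s2 sy).
rewrite scaler_sumr -big_split; apply: eq_bigr => a _ /=.
rewrite scaler_sumr -big_split; apply: eq_bigr => b _ /=.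
by rewrite mcoeffD mcoeffZ scalerA -scalerDl mulrDl mulrA.
Qed.

Lemma gca_basis_bracketC (a b : gca_basis) :
  gca_basis_bracket a b = - gca_basis_bracket b a.
Proof.
have N (k l : int) (v : gca F) : - ((k - l)%:~R *: v) = (l - k)%:~R *: v.
  by rewrite -scaleNr -rmorphN opprB.
case: a b => n [] m; rewrite /gca_basis_bracket ?(addrC m n).
all: by rewrite ?opprK ?oppr0 ?N.
Qed.

Lemma gca_bracketC (x y : gca F) : gca_bracket x y = - gca_bracket y x.
Proof.
rewrite /gca_bracket exchange_big -sumrN; apply: eq_bigr => b _.
rewrite -sumrN; apply: eq_bigr => a _ /=.
by rewrite gca_basis_bracketC scalerN mulrC.
Qed.

Lemma gca_bracket_linearr (x : gca F) : linear (gca_bracket x).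
Proof.
move=> c y1 y2; rewrite !(gca_bracketC x) gca_bracket_linearl.
by rewrite opprD scalerN.
Qed.

Lemma gca_bracketU (a b : gca_basis) :
  gca_bracket << a >> << b >> = gca_basis_bracket a b.
Proof.
have s k : (msupp (<< k >> : gca F) `<=` [fset k])%fset by exact: msuppU_le.
rewrite (gca_bracketEw (s a) (s b)) !big_seq_fset1 !mcoeffUU.
by rewrite mulr1 scale1r.
Qed.

Lemma gca_ind (P : gca F -> Prop) :
  P 0 -> (forall c k x, P x -> P (c *: << k >> + x)) -> forall x, P x.
Proof.
move=> P0 PD x; rewrite [x]monalgE; elim/big_rec: _ => // k y _ Py.
have -> : << x@_k *g k >> = x@_k *: << k >> :> gca F.
  by apply/malgP => l; rewrite mcoeffZ !mcoeffU mulr_natr.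
exact: PD.
Qed.

Definition gca_jacobiator (x y z : gca F) : gca F :=
  gca_bracket x (gca_bracket y z) + gca_bracket y (gca_bracket z x) +
  gca_bracket z (gca_bracket x y).

Lemma gca_jacobiatorC (x y z : gca F) :
  gca_jacobiator x y z = gca_jacobiator y z x.
Proof. by rewrite /gca_jacobiator [RHS]addrC addrA. Qed.

Lemma gca_jacobiator_linear (y z : gca F) :
  linear (fun x => gca_jacobiator x y z).
Proof.
move=> c x1 x2; rewrite /gca_jacobiator.
rewrite !(gca_bracket_linearr, gca_bracket_linearl) !scalerDr.
by rewrite [LHS](AC ((2*2)*2) ((1*3*5)*(2*4*6))).
Qed.

Lemma gca_bracket0l (x : gca F) : gca_bracket 0 x = 0.
Proof. by rewrite /gca_bracket msupp0 big_seq_fset0. Qed.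

Lemma gca_bracket0r (x : gca F) : gca_bracket x 0 = 0.
Proof. by rewrite gca_bracketC gca_bracket0l oppr0. Qed.

Lemma gca_bracket_scaler c (x y : gca F) :
  gca_bracket x (c *: y) = c *: gca_bracket x y.
Proof. by have := gca_bracket_linearr x c y 0; rewrite gca_bracket0r !addr0. Qed.

Lemma gca_bracketNr (x y : gca F) : gca_bracket x (- y) = - gca_bracket x y.
Proof. by rewrite -scaleN1r gca_bracket_scaler scaleN1r. Qed.

Lemma gca_jacobiatorU (a b c : gca_basis) :
  gca_jacobiator << a >> << b >> << c >> = 0.
Proof.
have [e eE] : exists e : gca_basis -> gca F, forall k, << k >> = e k.
  by exists (fun k => << k >>).
have eU k l : gca_bracket (e k) (e l) = gca_basis_bracket k l.
  by rewrite -!eE gca_bracketU.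
rewrite /gca_jacobiator !eE !eU.
case: a b c => n [] m [] p; rewrite /gca_basis_bracket ?eE;
  rewrite ?(gca_bracketNr, gca_bracket_scaler, gca_bracket0r) ?eU;
  rewrite /gca_basis_bracket ?eE.
all: have E1 : n + p + m = p + m + n by ring.
all: have E2 : m + n + p = p + m + n by ring.
all: rewrite ?E1 ?E2; refine (is_coordP (v := e _) _ _);
  [ repeat match goal with
    | |- is_coord _ (_ + _) _ => refine (is_coordD _ _)
    | |- is_coord _ (- _) _ => refine (is_coordN _)
    | |- is_coord _ (_ *: _) _ => refine (is_coordZ _ _)
    | |- is_coord _ 0 _ => exact (is_coord0 _)
    | |- is_coord _ _ _ => exact (is_coord1 _)
    end
  | ring ].
(* when all terms vanish, the common basis index is undetermined *)
Unshelve.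
all: exact: (gL 0).
Qed.

Lemma gca_jacobiator_ext (y z : gca F) :
  (forall a, gca_jacobiator << a >> y z = 0) ->
  forall x, gca_jacobiator x y z = 0.
Proof.
move=> J0; elim/gca_ind => [|c k x IHx].
  by rewrite /gca_jacobiator !(gca_bracket0l, gca_bracket0r) !addr0.
by rewrite gca_jacobiator_linear J0 IHx scaler0 addr0.
Qed.

Lemma gca_bracket_lie : is_lie_bracket gca_bracket.
Proof.
split; first exact: gca_bracket_linearl.
- exact: gca_bracket_linearr.
- elim/gca_ind => [|c k x IHx]; first exact: gca_bracket0l.
  rewrite gca_bracket_linearl !gca_bracket_linearr gca_bracketU IHx addr0.
  have -> : gca_basis_bracket k k = 0 by case: k => n //=; rewrite subrr scale0r.
  by rewrite scaler0 add0r (gca_bracketC x) scalerN addrN.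
move=> x y z; apply: gca_jacobiator_ext => a; rewrite gca_jacobiatorC.
apply: gca_jacobiator_ext => b; rewrite gca_jacobiatorC.
apply: gca_jacobiator_ext => c; rewrite gca_jacobiatorC.
exact: gca_jacobiatorU.
Qed.

End PlanarGalilean.

Arguments gca_basis_bracket {F} a b.
Arguments gca_bracket {F} x y.

(* Main.v *)
Require Import Defs.
From mathcomp Require Import all_boot all_order all_algebra.
From mathcomp Require Import finmap monalg.
From mathcomp Require Import reals complex.
From mathcomp Require Import ring zify.

(** The argument has two parts: a description of all derivations, and a family
    of elements, each of which is annihilated by very few derivations.

    Derivations. The element h = 3 L_0 + H_0 acts diagonally on the basis, with
    weights 3m on L_m and H_m, 3m + 1 on I_m and 3m - 1 on J_m. Given a
    derivation D, the components of D h of nonzero weight are removed by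
    subtracting an inner derivation, and the Leibniz rule for [h, b] then forces
    the remaining component to vanish, so that D preserves weights
    ([derivation_inner_on_grading], [grading_preserved]). A weight-preserving D
    is given by scalar functions of the index, which the Leibniz rule determines
    up to three constants. Hence D is the sum of an inner derivation and a
    multiple of the outer derivation that is the identity on the I_m and J_m and
    zero on the L_m and H_m ([derivation_classification]).

    Probes. For n <> 0 let y_n = L_n + I_2n + J_2n. The image of ad L_n omits
    I_2n and J_2n, so these two terms block both ad H_0 and the outer
    derivation: whatever annihilates y_n is ad (a y_n + c I_n + d J_n)
    ([derivation_kills_probe]).

    Conclusion. Let D_0 be a derivation that agrees with Delta at y_1 and y_2,
    and let Delta' = Delta - D_0, which is again 2-local. Comparing the pairs
    (y_1, y_n) and (y_2, y_n), the value of Delta' at y_n is a bracket of y_n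
    with an element built on y_1 and also with one built on y_2; the degrees of
    the two agree only at 0 ([probe_centralizer_brackets_disjoint]). So
    Delta' kills every y_n with n > 0, and Delta' x has the
    form [a y_n + c I_n + d J_n, x] for every such n. As n grows, the lowest degree
    of that bracket exceeds any bound, so Delta' x = 0 and Delta = D_0. *)

Set Implicit Arguments.
Unset Strict Implicit.
Unset Printing Implicit Defensive.

Import Order.TTheory GRing.Theory Num.Theory.
Local Open Scope ring_scope.

(** * Coordinates of brackets *)

Section Coordinates.
Variable F : fieldType.
Implicit Types (u x y : gca F) (b c k : gca_basis).

Definition gca_diag (f : gca_basis -> F) x : gca F :=
  \sum_(k <- msupp x) (f k * x@_k) *: << k >>.

Lemma mcoeff_gca_diag f x k : (gca_diag f x)@_k = f k * x@_k.
Proof.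
rewrite /gca_diag raddf_sum /=.
under eq_bigr => l _ do rewrite mcoeffZ mcoeffU.
have [kx|kx] := boolP (k \in msupp x).
  rewrite (big_fsetD1 k) //= eqxx mulr1 big1_fset ?addr0 // => l.
  by rewrite !inE => /andP[/negPf-> _] _; rewrite mulr0.
rewrite (mcoeff_outdom kx) mulr0 big1_fset // => l lx _.
by case: eqP => [lk|_]; [rewrite -lk lx in kx | rewrite mulr0].
Qed.

Lemma gca_diag_linear f : linear (gca_diag f).
Proof.
move=> a x y; apply/malgP => k.
by rewrite !(mcoeffD, mcoeffZ, mcoeff_gca_diag); ring.
Qed.

Lemma linear_map0 (V W : lmodType F) (f : V -> W) : linear f -> f 0 = 0.
Proof.
by move=> fL; have := fL (-1) 0 0; rewrite !scaleN1r oppr0 addr0 addNr.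
Qed.

Lemma linear_mapZ (V W : lmodType F) (f : V -> W) (a : F) (x : V) :
  linear f -> f (a *: x) = a *: f x.
Proof.
by move=> fL; have := fL a x 0; rewrite !addr0 (linear_map0 fL) addr0.
Qed.

Lemma gca_linear_ext (V : lmodType F) (f g : gca F -> V) :
  linear f -> linear g -> (forall b, f << b >> = g << b >>) -> f =1 g.
Proof.
move=> fL gL fg; elim/gca_ind => [|a b x IHx]; first by rewrite !linear_map0.
by rewrite fL gL fg IHx.
Qed.

Lemma gL_eq m n : (gL m == gL n) = (m == n).
Proof. by apply/eqP/eqP => [[]|->]. Qed.

Lemma gH_eq m n : (gH m == gH n) = (m == n).
Proof. by apply/eqP/eqP => [[]|->]. Qed.

Lemma gI_eq m n : (gI m == gI n) = (m == n).
Proof. by apply/eqP/eqP => [[]|->]. Qed.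

Lemma gJ_eq m n : (gJ m == gJ n) = (m == n).
Proof. by apply/eqP/eqP => [[]|->]. Qed.

Definition gca_basis_eqE := (gL_eq, gH_eq, gI_eq, gJ_eq).

(** The coordinate at [c] of the bracket of [u] with the basis vector of [b].
    It involves at most two coordinates of [u], so that an identity in the
    algebra becomes a family of scalar identities that can be read off one by
    one. *)
Definition ad_coef u b c : F :=
  match b, c with
  | gL n, gL s => (n + n - s)%:~R * u@_(gL (s - n))
  | gL n, gH s => (n - s)%:~R * u@_(gH (s - n))
  | gL n, gI s => (n + n - s)%:~R * u@_(gI (s - n))
  | gL n, gJ s => (n + n - s)%:~R * u@_(gJ (s - n))
  | gH n, gH s => n%:~R * u@_(gL (s - n))
  | gH n, gI s => - u@_(gI (s - n))
  | gH n, gJ s => u@_(gJ (s - n))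
  | gI n, gI s => (n + n - s)%:~R * u@_(gL (s - n)) + u@_(gH (s - n))
  | gJ n, gJ s => (n + n - s)%:~R * u@_(gL (s - n)) - u@_(gH (s - n))
  | _, _ => 0
  end.

Lemma mcoeff_bracketr u b c : (gca_bracket u << b >>)@_c = ad_coef u b c.
Proof.
have coefL : linear (fun u => ad_coef u b c : F^o).
  move=> a x y; rewrite /ad_coef /GRing.scale /=.
  by case: b c => n [] s; rewrite ?(mcoeffD, mcoeffZ); ring.
have brL : linear (fun u => (gca_bracket u << b >>)@_c : F^o).
  by move=> a x y; rewrite gca_bracket_linearl mcoeffD mcoeffZ.
apply: (gca_linear_ext brL coefL) => k {brL coefL}; rewrite gca_bracketU.
have e (m n s : int) : (m == s - n) = (n + m == s) by lia.
case: k b c => m [] n [] s;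
  rewrite /= ?(mcoeffN, mcoeffZ, mcoeff0, mcoeffU, gca_basis_eqE) ?e;
  rewrite ?(mulr0, oppr0, addr0) //=.
all: have [?|_] := eqVneq (n + m) s; rewrite ?mulr0 ?oppr0 ?addr0 //.
all: by subst s; ring.
Qed.

Lemma mcoeff_bracketl u b c : (gca_bracket << b >> u)@_c = - ad_coef u b c.
Proof. by rewrite gca_bracketC mcoeffN mcoeff_bracketr. Qed.

Lemma gca_bracketDl x1 x2 y :
  gca_bracket (x1 + x2) y = gca_bracket x1 y + gca_bracket x2 y.
Proof. by have := gca_bracket_linearl y 1 x1 x2; rewrite !scale1r. Qed.

Lemma gca_bracketZl (a : F) x y :
  gca_bracket (a *: x) y = a *: gca_bracket x y.
Proof. exact: linear_mapZ (gca_bracket_linearl y). Qed.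

Lemma gca_bracketBl x1 x2 y :
  gca_bracket (x1 - x2) y = gca_bracket x1 y - gca_bracket x2 y.
Proof.
have := gca_bracket_linearl y (-1) x2 x1.
by rewrite !scaleN1r !(addrC (- _)).
Qed.

Lemma gca_bracketBr x y1 y2 :
  gca_bracket x (y1 - y2) = gca_bracket x y1 - gca_bracket x y2.
Proof. by rewrite !(gca_bracketC x) gca_bracketBl opprD. Qed.

(** The eigenvalues of [ad grading_elt]. The factor 3 makes the index and the
    charge (0 on L and H, 1 on I, -1 on J) recoverable from the single integer
    [3 * index + charge], so one grading element does the work of both L_0 and
    H_0. *)
Definition gca_weight b : int :=
  match b with
  | gL m | gH m => 3 * m
  | gI m => 3 * m + 1
  | gJ m => 3 * m - 1
  end.

Definition grading_elt : gca F := 3%:R *: << gL 0 >> + << gH 0 >>.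

Lemma mcoeff_grading x k :
  (gca_bracket grading_elt x)@_k = (gca_weight k)%:~R * x@_k.
Proof.
rewrite /grading_elt gca_bracketDl gca_bracketZl mcoeffD mcoeffZ.
transitivity (3%:R * - ad_coef x (gL 0) k - ad_coef x (gH 0) k).
  by congr (_ * _ + _); apply: mcoeff_bracketl.
by case: k => s; rewrite /= ?subr0; ring.
Qed.

Lemma grading_basis b :
  gca_bracket grading_elt << b >> = (gca_weight b)%:~R *: << b >>.
Proof.
apply/malgP => k; rewrite mcoeff_grading mcoeffZ mcoeffU.
by case: eqP => [->|]; rewrite ?mulr0.
Qed.

End Coordinates.

(** * Derivations *)

Section Derivations.
Variable F : numFieldType.
Implicit Types (u x y : gca F) (b c k : gca_basis) (D : gca F -> gca F).
Let derivation D := is_derivation (@gca_bracket F) D.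

Lemma derivationB D1 D2 :
  derivation D1 -> derivation D2 -> derivation (fun x => D1 x - D2 x).
Proof.
move=> [L1 M1] [L2 M2]; split=> [a x y|x y].
  by rewrite L1 L2 scalerBr opprD addrACA.
by rewrite M1 M2 gca_bracketBl gca_bracketBr opprD addrACA.
Qed.

Lemma derivation_ad u : derivation (gca_bracket u).
Proof.
split=> [|x y]; first exact: gca_bracket_linearr.
have [_ _ _ /(_ u x y)/eqP] := gca_bracket_lie F.
rewrite -addrA addr_eq0 => /eqP->; rewrite opprD addrC.
by rewrite (gca_bracketC (gca_bracket u x) y) (gca_bracketC u y) gca_bracketNr.
Qed.

Lemma derivation_coef D a b c : derivation D ->
  (D (gca_basis_bracket a b))@_c =
  ad_coef (D << a >>) b c - ad_coef (D << b >>) a c.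
Proof.
move=> [_ DM].
by rewrite -gca_bracketU DM mcoeffD mcoeff_bracketr mcoeff_bracketl.
Qed.

(** The Leibniz rule for [h, b], where h is the grading element: [D b] fails to
    have the weight of [b] only as far as [D h] fails to vanish. *)
Lemma grading_derivation D b k : derivation D ->
  (gca_weight b - gca_weight k)%:~R * (D << b >>)@_k =
  ad_coef (D (grading_elt F)) b k.
Proof.
move=> [DL DM]; have := congr1 (mcoeff k) (DM (grading_elt F) << b >>).
rewrite grading_basis linear_mapZ // mcoeffZ mcoeffD mcoeff_grading.
rewrite mcoeff_bracketr => E; rewrite rmorphB mulrBl /= E; ring.
Qed.

(** Since [u, h] rescales the weight-w part of u by -w, dividing [D h] by minus
    the weights gives a u such that (D - ad u) h has weight 0, that is, lies in
    the span of L_0 and H_0. By [grading_derivation] at k = b, such an element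
    acts on every basis vector by the scalar 0, which kills both of its
    coordinates. *)
Lemma derivation_inner_on_grading D : derivation D ->
  exists u, derivation (fun x => D x - gca_bracket u x) /\
    D (grading_elt F) = gca_bracket u (grading_elt F).
Proof.
move=> dD; pose f k : F := - (gca_weight k)%:~R^-1.
(* in weight 0 the inverse is the junk value 0, and u has no component there *)
pose u := gca_diag f (D (grading_elt F)); exists u.
have dDu := derivationB dD (derivation_ad u); split=> //.
set D' := fun x => _ in dDu.
pose z := D' (grading_elt F).
have zw k : gca_weight k != 0 -> z@_k = 0.
  move=> wk; rewrite /z /D' gca_bracketC opprK mcoeffD mcoeff_grading.
  rewrite mcoeff_gca_diag /f mulNr mulrN mulrA mulfV ?intr_eq0 //.
  by rewrite mul1r subrr.
have zb b : ad_coef z b b = 0.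
  by rewrite -grading_derivation // subrr mul0r.
have zL : z@_(gL 0) = 0.
  (* on L_1 the coefficient of L_0 acts by 1 and that of H_0 by 0 *)
  by have := zb (gL 1); rewrite /= subrr addrK mul1r.
have zH : z@_(gH 0) = 0.
  by have := zb (gI 0); rewrite /= subrr mul0r add0r.
have z0 : z = 0.
  apply/malgP => k; rewrite mcoeff0.
  have [wk|] := eqVneq (gca_weight k) 0; last exact: zw.
  case: k wk => m /= wk; try lia; have -> : m = 0 by lia.
    exact: zL.
  exact: zH.
by move/eqP: z0; rewrite subr_eq0 => /eqP.
Qed.

Lemma grading_preserved D b k :
  derivation D -> D (grading_elt F) = 0 -> gca_weight b != gca_weight k ->
  (D << b >>)@_k = 0.
Proof.
move=> dD D0 wbk; have := grading_derivation b k dD; rewrite D0.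
have -> : ad_coef (0 : gca F) b k = 0.
  by rewrite -mcoeff_bracketr gca_bracket0l mcoeff0.
by move/eqP; rewrite mulf_eq0 intr_eq0 subr_eq0 (negPf wbk) => /eqP.
Qed.

Lemma int_additive (f : int -> F) :
  (forall m n, f (m + n) = f m + f n) -> forall n, f n = n%:~R * f 1.
Proof.
move=> fD.
have f0 : f 0 = 0 by apply/(addrI (f 0)); rewrite -fD !addr0.
have fS n : f (n + 1) = f n + f 1 by rewrite fD.
elim/int_rect => [|n IHn|n IHn]; first by rewrite f0 mul0r.
  by rewrite -addn1 PoszD fS IHn rmorphD mulrDl mul1r.
have := fS (- n.+1%:Z); have -> : - n.+1%:Z + 1 = - n%:Z by lia.
rewrite IHn => fn; have -> : f (- n.+1%:Z) = (- n%:Z)%:~R * f 1 - f 1.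
  by rewrite fn addrK.
by rewrite -addn1 PoszD opprD rmorphB /=; ring.
Qed.

(** A weight-preserving derivation sends L_n to al n L_n + be n H_n, H_n to
    ga n L_n + ep n H_n, and acts on I_n and J_n by the scalars io n and ka n.
    The four hypotheses are the Leibniz rules for [H_n, H_m], [H_n, I_m],
    [H_n, J_m] and [L_n, I_m]. The first makes ga linear; ga enters the second
    and the third with opposite signs, and its quadratic contribution can only
    cancel if ga = 0. Then ep is additive, io and ka are its translates, and the
    last rule gives be = 0 (at m = n) and al = ep (at m = n + 1). *)
Lemma structure_constants_solution (al be ga ep io ka : int -> F) :
  (forall m n, m%:~R * ga n = n%:~R * ga m) ->
  (forall m n, io (m + n) = (m - n)%:~R * ga n + ep n + io m) ->
  (forall m n, ka (m + n) = ep n - (m - n)%:~R * ga n + ka m) ->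
  (forall m n, (m - n)%:~R * io (m + n) =
     (m - n)%:~R * al n + be n + (m - n)%:~R * io m) ->
  exists e i j, forall m,
    [/\ al m = m%:~R * e, be m = 0, ga m = 0, ep m = m%:~R * e &
        io m = m%:~R * e + i /\ ka m = m%:~R * e + j].
Proof.
move=> HH HI HJ LI.
have ga1 : ga 1 = 0.
  have g2 : ga 2 = 2%:~R * ga 1 by rewrite -HH mul1r.
  have I11 := HI 1 1; have I02 := HI 0 2; have I01 : io 1 = _ := HI 0 1.
  have J11 := HJ 1 1; have J02 := HJ 0 2; have J01 : ka 1 = _ := HJ 0 1.
  (* two computations of io 2, and below of ka 2, from the values at 0 and 1 *)
  have EI : ep 1 + (ep 1 - ga 1 + io 0) = ep 2 - 4%:R * ga 1 + io 0.
    have := etrans (esym I11) I02; rewrite g2 subrr mul0r add0r.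
    by rewrite I01 => E; apply: etrans (etrans _ E) _; ring.
  have EJ : ep 1 + (ep 1 + ga 1 + ka 0) = ep 2 + 4%:R * ga 1 + ka 0.
    have := etrans (esym J11) J02; rewrite g2 subrr mul0r subr0.
    by rewrite J01 => E; apply: etrans (etrans _ E) _; ring.
  have : 6%:R * ga 1 =
    (ep 2 + 4%:R * ga 1 + ka 0) - (ep 1 + (ep 1 + ga 1 + ka 0))
    - ((ep 2 - 4%:R * ga 1 + io 0) - (ep 1 + (ep 1 - ga 1 + io 0))) by ring.
  by rewrite EI EJ !subrr => /eqP; rewrite mulf_eq0 pnatr_eq0 => /eqP.
have ga0 n : ga n = 0 by have := HH 1 n; rewrite ga1 mulr0 mul1r.
have ioE n : io n = ep n + io 0 by have := HI 0 n; rewrite ga0 mulr0 !add0r.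
have kaE n : ka n = ep n + ka 0.
  by have := HJ 0 n; rewrite ga0 mulr0 subr0 add0r.
have epD m n : ep (m + n) = ep m + ep n.
  have := HI m n; rewrite ga0 mulr0 add0r (ioE (m + n)) (ioE m) addrA.
  by move=> /addIr->; exact: addrC.
have epE := int_additive epD.
have be0 n : be n = 0 by have := LI n n; rewrite subrr !mul0r addr0 add0r.
have alE n : al n = ep n.
  have := LI (n + 1) n; have -> : n + 1 - n = 1 by lia.
  rewrite be0 !mul1r addr0 (HI (n + 1) n) ga0 mulr0 add0r.
  by move=> /addIr->.
exists (ep 1), (io 0), (ka 0) => m.
by split; rewrite ?alE ?be0 ?ga0 -?epE.
Qed.

Lemma grading_derivation_diag D :
  derivation D -> D (grading_elt F) = 0 ->
  exists e i j : F, [/\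
    forall m, D << gL m >> = (m%:~R * e) *: << gL m >>,
    forall m, D << gH m >> = (m%:~R * e) *: << gH m >>,
    forall m, D << gI m >> = (m%:~R * e + i) *: << gI m >>
  & forall m, D << gJ m >> = (m%:~R * e + j) *: << gJ m >>].
Proof.
move=> dD D0; have Dw b k := @grading_preserved D b k dD D0.
pose al n := (D << gL n >>)@_(gL n); pose be n := (D << gL n >>)@_(gH n).
pose ga n := (D << gH n >>)@_(gL n); pose ep n := (D << gH n >>)@_(gH n).
pose io n := (D << gI n >>)@_(gI n); pose ka n := (D << gJ n >>)@_(gJ n).
have D00 : D 0 = 0 by exact: linear_map0 dD.1.
have DZ a x k : (D (a *: x))@_k = a * (D x)@_k.
  by rewrite (linear_mapZ a x dD.1) mcoeffZ.
have DN x k : (D (- x))@_k = - (D x)@_k by rewrite -scaleN1r DZ mulN1r.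
have eN (m n : int) : m + n - m = n by lia.
have HH m n : m%:~R * ga n = n%:~R * ga m.
  have := derivation_coef (gH n) (gH m) (gH (m + n)) dD.
  rewrite /= eN addrK D00 mcoeff0 => /esym/eqP.
  by rewrite subr_eq0 => /eqP.
have HI m n : io (m + n) = (m - n)%:~R * ga n + ep n + io m.
  have := derivation_coef (gH n) (gI m) (gI (m + n)) dD.
  rewrite /= eN addrK opprK -[_@_ _]/(io _) => ->.
  by have -> : m + m - (m + n) = m - n by lia.
have HJ m n : ka (m + n) = ep n - (m - n)%:~R * ga n + ka m.
  have := derivation_coef (gH n) (gJ m) (gJ (m + n)) dD.
  rewrite /= eN addrK DN => /(canRL opprK); rewrite -[_@_ _]/(ka _) => ->.
  have -> : m + m - (m + n) = m - n by lia.
  by rewrite -/(ga n) -/(ep n) -/(ka m); ring.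
have LI m n : (m - n)%:~R * io (m + n) =
    (m - n)%:~R * al n + be n + (m - n)%:~R * io m.
  have := derivation_coef (gL n) (gI m) (gI (m + n)) dD.
  rewrite /= eN addrK DZ => E; apply: (etrans E).
  have -> : m + m - (m + n) = m - n by lia.
  have -> : n + n - (m + n) = - (m - n) by lia.
  by rewrite -/(al n) -/(be n) -/(io m) rmorphN /=; ring.
have [e [i [j sol]]] := structure_constants_solution HH HI HJ LI.
have diag b f : (D << b >>)@_b = f ->
    (forall k, k != b -> (D << b >>)@_k = 0) -> D << b >> = f *: << b >>.
  move=> Db Dk; apply/malgP => k; rewrite mcoeffZ mcoeffU.
  by have [<-|kb] := eqVneq b k; rewrite ?mulr1 // mulr0 Dk // eq_sym.
exists e, i, j; split=> m; have [alE be0 ga0 epE [ioE kaE]] := sol m.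
- apply: diag; [exact: alE | case] => s; rewrite ?gca_basis_eqE => sm.
  + by apply: Dw => /=; lia.
  + have [->|?] := eqVneq s m; first exact: be0.
    by apply: Dw => /=; lia.
  + by apply: Dw => /=; lia.
  + by apply: Dw => /=; lia.
- apply: diag; [exact: epE | case] => s; rewrite ?gca_basis_eqE => sm.
  + have [->|?] := eqVneq s m; first exact: ga0.
    by apply: Dw => /=; lia.
  + by apply: Dw => /=; lia.
  + by apply: Dw => /=; lia.
  + by apply: Dw => /=; lia.
- by apply: diag; [exact: ioE | case] => s; rewrite ?gca_basis_eqE => sm;
    apply: Dw => /=; lia.
- by apply: diag; [exact: kaE | case] => s; rewrite ?gca_basis_eqE => sm;
    apply: Dw => /=; lia.
Qed.

Definition IJ_degree b : F :=
  match b with gI _ | gJ _ => 1 | gL _ | gH _ => 0 end.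

(** Every derivation is inner up to a multiple of one outer derivation. The
    remaining constants e, i, j of [grading_derivation_diag] are absorbed as
    follows: ad L_0 multiplies by the index, ad H_0 acts as 1 on I and -1 on J,
    and the outer derivation as 1 on both; whence e, (i - j)/2 and (i + j)/2. *)
Lemma derivation_classification D : derivation D ->
  exists u a, forall x,
    D x = gca_bracket u x + a *: gca_diag IJ_degree x.
Proof.
move=> dD; have [v [dv /eqP]] := derivation_inner_on_grading dD.
rewrite -subr_eq0 => /eqP Dv0.
have [e [i [j [DL DH DI DJ]]]] := grading_derivation_diag dv Dv0.
pose w : gca F := e *: << gL 0 >> + ((i - j) / 2%:R) *: << gH 0 >>.
exists (v + w), ((i + j) / 2%:R) => x.
rewrite gca_bracketDl -addrA; apply/eqP; rewrite addrC -subr_eq; apply/eqP.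
have wL : linear (fun x => gca_bracket w x +
    ((i + j) / 2%:R) *: gca_diag IJ_degree x).
  move=> c y z; rewrite gca_bracket_linearr gca_diag_linear.
  by rewrite !scalerDr !scalerA (mulrC _ c) addrACA.
have wE b : gca_bracket w << b >> = e *: gca_basis_bracket (gL 0) b +
    ((i - j) / 2%:R) *: gca_basis_bracket (gH 0) b.
  by rewrite gca_bracketDl; congr (_ + _); rewrite gca_bracketZl gca_bracketU.
apply: (gca_linear_ext dv.1 wL) => b {x}.
have -> : gca_diag IJ_degree << b >> = IJ_degree b *: << b >>.
  apply/malgP => k; rewrite mcoeff_gca_diag mcoeffZ mcoeffU.
  by case: eqP => [->|]; rewrite ?mulr0.
rewrite wE; case: b => m /=.
- by rewrite DL scalerN !(scaler0, scale0r, addr0) scalerA ?subr0 mulrC.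
- by rewrite DH !(scaler0, scale0r, addr0) scalerA mulrC.
- rewrite DI !addr0 ?subr0 !scalerA -!scalerDl; congr (_ *: _).
  by field.
- rewrite DJ !addr0 ?subr0 scalerN -scaleNr !scalerA -!scalerDl; congr (_ *: _).
  by field.
Qed.

(** * Probe elements *)

Lemma mcoeff_comb2 (a1 a2 : F) b1 b2 k :
  (a1 *: << b1 >> + a2 *: << b2 >> : gca F)@_k =
  a1 * (b1 == k)%:R + a2 * (b2 == k)%:R.
Proof. by rewrite mcoeffD; congr (_ + _); rewrite mcoeffZ mcoeffU. Qed.

Definition probe (n : int) : gca F :=
  << gL n >> + (<< gI (n + n) >> + << gJ (n + n) >>).

Lemma mcoeff_bracket_probe u (n : int) k :
  (gca_bracket u (probe n))@_k =
  ad_coef u (gL n) k + (ad_coef u (gI (n + n)) k + ad_coef u (gJ (n + n)) k).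
Proof.
have brD x y z : gca_bracket x (y + z) = gca_bracket x y + gca_bracket x z.
  by rewrite !(gca_bracketC x) gca_bracketDl opprD.
by rewrite /probe !brD 2!mcoeffD; congr (_ + (_ + _)); apply: mcoeff_bracketr.
Qed.

(** I_m and J_m commute with L_m and with all I and J, so every element of this
    form centralizes [probe m]. *)
Definition probe_centralizer_elt (m : int) (a c d : F) : gca F :=
  a *: probe m + (c *: << gI m >> + d *: << gJ m >>).

(** Write D = ad u + l * outer. In the L and H coordinates, D y_n = 0 says that
    u has L-part a L_n and H-part b H_0. After subtracting a y_n from u, only
    b H_0 and I, J terms remain. As [I_k, L_n] = (n - k) I_(n+k), every I_k
    with k <> n must drop out, and the coefficient at I_2n, to which the I_k
    cannot contribute, reads b + l = 0; at J_2n it reads - b + l = 0. *)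
Lemma derivation_kills_probe D (n : int) :
  n != 0 -> derivation D -> D (probe n) = 0 ->
  exists a c d : F, forall x,
    D x = gca_bracket (probe_centralizer_elt n a c d) x.
Proof.
move=> n0 dD; have [u [l DE]] := derivation_classification dD.
rewrite DE => Dn0; pose a := u@_(gL n); pose v := u - a *: probe n.
have uE : u = a *: probe n + v by rewrite addrC subrK.
have v0 k : ad_coef v (gL n) k +
    (ad_coef v (gI (n + n)) k + ad_coef v (gJ (n + n)) k) +
    l * (IJ_degree k * (probe n)@_k) = 0.
  rewrite -mcoeff_bracket_probe -mcoeff_gca_diag -mcoeffZ -mcoeffD.
  have [_ _ brxx _] := gca_bracket_lie F.
  by rewrite gca_bracketBl gca_bracketZl brxx scaler0 subr0 Dn0 mcoeff0.
have eN (k m : int) : k + m - m = k by lia.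
have e2 (k : int) : k + n - (n + n) = k - n by lia.
have e3 (k : int) : n + n - (k + n) = n - k by lia.
have probeL : (probe n)@_(gL n) = 1.
  by rewrite !mcoeffD !mcoeffU eqxx !addr0.
have probeI (k : int) : (probe n)@_(gI (k + n)) = (k == n)%:R.
  rewrite !mcoeffD !mcoeffU /= gI_eq add0r addr0 eq_sym.
  by rewrite (inj_eq (addIr n)).
have probeJ (k : int) : (probe n)@_(gJ (k + n)) = (k == n)%:R.
  rewrite !mcoeffD !mcoeffU /= gJ_eq !add0r eq_sym.
  by rewrite (inj_eq (addIr n)).
have nz (z : int) (f : F) : z != 0 -> z%:~R * f = 0 -> f = 0.
  by move=> z0 /eqP; rewrite mulf_eq0 intr_eq0 (negPf z0) => /eqP.
have vL (k : int) : v@_(gL k) = 0.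
  have [->|kn] := eqVneq k n.
    by rewrite /v mcoeffB mcoeffZ probeL mulr1 subrr.
  have := v0 (gL (k + n)); rewrite /= eN e3 !addr0 mul0r mulr0 addr0.
  by apply: nz; lia.
have vH (k : int) : k != 0 -> v@_(gH k) = 0.
  move=> k0; have := v0 (gH (k + n)); rewrite /= eN !addr0 mul0r mulr0 addr0.
  by apply: nz; lia.
have vI (k : int) : k != n -> v@_(gI k) = 0.
  move=> kn; have := v0 (gI (k + n)).
  rewrite /= eN e2 e3 vL vH ?probeI ?(negPf kn) ?mulr0 ?addr0; last by lia.
  by apply: nz; lia.
have vJ (k : int) : k != n -> v@_(gJ k) = 0.
  move=> kn; have := v0 (gJ (k + n)).
  rewrite /= eN e2 e3 vL vH ?probeJ ?(negPf kn); last by lia.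
  rewrite ?mulr0 ?addr0 ?subr0.
  by rewrite add0r addr0; apply: nz; lia.
have hI : v@_(gH 0) + l = 0.
  have := v0 (gI (n + n)); rewrite /= e2 subrr mul0r vL mulr0 !add0r addr0.
  by rewrite probeI eqxx !mulr1.
have hJ : - v@_(gH 0) + l = 0.
  have := v0 (gJ (n + n)); rewrite /= e2 subrr mul0r vL mulr0 !add0r.
  by rewrite probeJ eqxx !mulr1.
have l0 : l = 0.
  have : 2%:R * l = (v@_(gH 0) + l) + (- v@_(gH 0) + l) by ring.
  by rewrite hI hJ addr0 => /eqP; rewrite mulf_eq0 pnatr_eq0 => /eqP.
have vH0 : v@_(gH 0) = 0 by rewrite -hI l0 addr0.
exists a, (v@_(gI n)), (v@_(gJ n)) => x.
clearbody v; rewrite DE l0 scale0r addr0 {1}uE; congr (gca_bracket (_ + _) x).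
apply/malgP => k; rewrite mcoeff_comb2.
case: k => m; rewrite ?gca_basis_eqE /= ?mulr0 ?addr0 ?add0r.
- exact: vL.
- by have [->|/vH->] := eqVneq m 0.
- by have [->|/vI->] := eqVneq m n; rewrite ?mulr1 ?mulr0.
- by have [->|/vJ->] := eqVneq m n; rewrite ?mulr1 ?mulr0.
Qed.

Lemma mcoeff_probe_centralizer (m : int) (a c d : F) k :
  (probe_centralizer_elt m a c d)@_k =
  match k with
  | gL s => a * (m == s)%:R
  | gH _ => 0
  | gI s => a * (m + m == s)%:R + c * (m == s)%:R
  | gJ s => a * (m + m == s)%:R + d * (m == s)%:R
  end.
Proof.
rewrite /probe_centralizer_elt mcoeffD mcoeff_comb2 mcoeffZ.
rewrite /probe 2!mcoeffD !mcoeffU.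
by case: k => s; rewrite ?gca_basis_eqE /= ?(mulr0, addr0, add0r).
Qed.

(** The L-parts of the two sides sit in degrees p + n and q + n, hence both
    vanish, which forces a1 = a2 = 0. What remains is the bracket of L_n with
    multiples of I_p, J_p on one side and of I_q, J_q on the other, again in
    degrees p + n and q + n. *)
Lemma probe_centralizer_brackets_disjoint (p q n : int) (a1 c1 d1 a2 c2 d2 : F) :
  p != q -> n != p -> n != q ->
  gca_bracket (probe_centralizer_elt p a1 c1 d1) (probe n) =
    gca_bracket (probe_centralizer_elt q a2 c2 d2) (probe n) ->
  gca_bracket (probe_centralizer_elt p a1 c1 d1) (probe n) = 0.
Proof.
move=> pq np nq; have v1E := mcoeff_probe_centralizer p a1 c1 d1.
have v2E := mcoeff_probe_centralizer q a2 c2 d2.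
move: (probe_centralizer_elt p _ _ _) v1E => v1 v1E.
move: (probe_centralizer_elt q _ _ _) v2E => v2 v2E E.
have coefE k := etrans (esym (mcoeff_bracket_probe v1 n k))
  (etrans (congr1 (mcoeff k) E) (mcoeff_bracket_probe v2 n k)).
have eN (k m : int) : k + m - m = k by lia.
have a10 : a1 = 0.
  have := coefE (gL (p + n)); rewrite /= eN v1E v2E eqxx eq_sym (negPf pq).
  rewrite !(mulr0, addr0) mulr1 => /eqP; rewrite mulf_eq0 intr_eq0.
  by case/orP => [|/eqP//]; lia.
have a20 : a2 = 0.
  have := coefE (gL (q + n)); rewrite /= eN v1E v2E eqxx (negPf pq).
  rewrite !(mulr0, addr0) mulr1 => /esym/eqP; rewrite mulf_eq0 intr_eq0.
  by case/orP => [|/eqP//]; lia.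
subst a1 a2; apply/malgP => k; rewrite mcoeff0.
apply: etrans (mcoeff_bracket_probe v1 n k) _; have := coefE k.
case: k => s /=; rewrite !v1E !v2E !(mul0r, mulr0, add0r, addr0) //.
- have [e|_] := eqVneq p (s - n); last by rewrite !mulr0.
  by move=> ->; rewrite -e eq_sym (negPf pq) !mulr0.
- rewrite !subr0; have [e|_] := eqVneq p (s - n); last by rewrite !mulr0.
  by move=> ->; rewrite -e eq_sym (negPf pq) !mulr0.
Qed.

(** * Degrees and 2-local derivations *)

Definition gca_degree b : int :=
  match b with gL m | gH m | gI m | gJ m => m end.

Lemma degree_bounded_below x :
  exists N : int, forall k, (gca_degree k < N)%R -> x@_k = 0.
Proof.
elim/gca_ind: x => [|a b x [N xN]]; first by exists 0 => k _; rewrite mcoeff0.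
exists (Num.min N (gca_degree b)) => k; rewrite lt_min => /andP[kN kb].
rewrite mcoeffD mcoeffZ mcoeffU xN // addr0.
by case: eqP kb => [->|]; rewrite ?ltxx ?mulr0.
Qed.

Lemma ad_coef_degree x b k :
  (forall j, gca_degree j = gca_degree k - gca_degree b -> x@_j = 0) ->
  ad_coef x b k = 0.
Proof.
move=> x0; case: b k x0 => n [] s /= x0 //;
  by rewrite !x0 // ?(mulr0, oppr0, addr0, subr0).
Qed.

(** All basis vectors in the left argument have degree at least m, so the
    bracket raises degrees by at least m. *)
Lemma mcoeff_probe_centralizer_bracket (m : int) (a c d : F) x k : (0 < m)%R ->
  (forall j, (gca_degree j <= gca_degree k - m)%R -> x@_j = 0) ->
  (gca_bracket (probe_centralizer_elt m a c d) x)@_k = 0.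
Proof.
move=> m0 x0.
have b0 b : (m <= gca_degree b)%R -> (gca_bracket << b >> x)@_k = 0.
  move=> mb; rewrite mcoeff_bracketl ad_coef_degree ?oppr0 // => j jE.
  by apply: x0; lia.
have Z0 (f : F) y : (gca_bracket y x)@_k = 0 -> (gca_bracket (f *: y) x)@_k = 0.
  by move=> y0; rewrite gca_bracketZl mcoeffZ y0 mulr0.
have D0 y z : (gca_bracket y x)@_k = 0 -> (gca_bracket z x)@_k = 0 ->
    (gca_bracket (y + z) x)@_k = 0.
  by move=> y0 z0; rewrite gca_bracketDl mcoeffD y0 z0 addr0.
have m2 : (m <= m + m)%R by lia.
have bL := b0 (gL m) (lexx m); have bI := b0 (gI m) (lexx m).
have bJ := b0 (gJ m) (lexx m).
have bI2 := b0 (gI (m + m)) m2; have bJ2 := b0 (gJ (m + m)) m2.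
exact: (D0 _ _ (Z0 a _ (D0 _ _ bL (D0 _ _ bI2 bJ2)))
               (D0 _ _ (Z0 c _ bI) (Z0 d _ bJ))).
Qed.

(** The derivation D_0 chosen at the pair of probes 1 and 2 turns out to be
    Delta itself: the two probes make Delta - D_0 vanish at all probes of
    positive index, and those of large index make it vanish everywhere. *)
Lemma two_local_is_derivation Delta :
  is_2local_derivation (@gca_bracket F) Delta -> derivation Delta.
Proof.
move=> Delta2; have [D0 [dD0 D01 D02]] := Delta2 (probe 1) (probe 2).
pose Delta' x := Delta x - D0 x.
have Delta'2 x (n : int) : n != 0 -> Delta' (probe n) = 0 ->
    exists a c d : F, Delta' x = gca_bracket (probe_centralizer_elt n a c d) x.
  move=> n0 Dn0; have [D [dD Dn Dx]] := Delta2 (probe n) x.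
  have dDD := derivationB dD dD0.
  have Dn0' : D (probe n) - D0 (probe n) = 0 by rewrite -Dn.
  have [a [c [d DE]]] := derivation_kills_probe n0 dDD Dn0'.
  by exists a, c, d; rewrite /Delta' Dx; apply: DE.
have Delta'1 : Delta' (probe 1) = 0 by rewrite /Delta' D01 subrr.
have Delta'22 : Delta' (probe 2) = 0 by rewrite /Delta' D02 subrr.
have probe0 (n : int) : (0 < n)%R -> Delta' (probe n) = 0.
  move=> n0; have [->//|n1] := eqVneq n 1; have [->//|n2] := eqVneq n 2.
  have [//|a1 [c1 [d1 E1]]] := Delta'2 (probe n) 1 _ Delta'1.
  have [//|a2 [c2 [d2 E2]]] := Delta'2 (probe n) 2 _ Delta'22.
  have E12 := etrans (esym E1) E2; apply: etrans E1 _.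
  exact: (@probe_centralizer_brackets_disjoint 1 2 n _ _ _ _ _ _ isT n1 n2 E12).
have Delta'0 x : Delta' x = 0.
  apply/malgP => k; rewrite mcoeff0; have [N xN] := degree_bounded_below x.
  (* n exceeds deg k - N, so x vanishes in degrees up to deg k - n *)
  pose n : int := `|gca_degree k - N| + 1.
  have n0 : (0 < n)%R by rewrite /n; lia.
  have [|a [c [d ->]]] := Delta'2 x n _ (probe0 n n0); first by lia.
  apply: mcoeff_probe_centralizer_bracket => // j jk.
  by apply: xN; rewrite /n in jk; lia.
have DeltaE x : Delta x = D0 x.
  by apply/eqP; rewrite -subr_eq0 -/(Delta' x) Delta'0.
by split=> [a x y|x y]; rewrite !DeltaE; [apply: dD0.1 | apply: dD0.2].
Qed.

End Derivations.

(* For [R : realType], [R[i]] is the field of complex numbers. *)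
Theorem theorem3p6 (R : realType) (Delta : gca R[i] -> gca R[i]) :
  is_2local_derivation (@gca_bracket R[i]) Delta ->
  is_derivation (@gca_bracket R[i]) Delta.
Proof. exact: two_local_is_derivation. Qed.
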